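(* Let $\mathcal{V}$ be a collection of closed subsets of $\mathbb{R}^d$ and let $\mathcal{U}=\{V^c : V\in\mathcal{V}\}$. Assume that for every $x\in\mathbb{R}^d$ there is a $U\in\mathcal{U}$ with $x\in U$. Then for every probability measure $P$ on the Borel sets of $\mathbb{R}^d$, the function $x\mapsto D(x;P,\mathcal{U})$ is upper semicontinuous. Moreover, assume in addition that $D(x;P,\mathcal{U})>0$ for at least one $x\in\mathbb{R}^d$ and that $\lim_{\|x\|\to+\infty}D(x;P,\mathcal{U})=0$. Then the set $C(P,\mathcal{U})$ on which $D(\cdot\,;P,\mathcal{U})$ reaches its maximum is equal to the minimal non-empty set $S_\alpha$, that is, $$C(P,\mathcal{U})=\bigcap_{\alpha:\,S_\alpha(P,\mathcal{U})\ne\emptyset}S_\alpha(P,\mathcal{U}).$$ The set $C(P,\mathcal{U})$ is a non-empty compact set, and $$C(P,\mathcal{U})=\bigcap_{V\in\mathcal{V},\,P(V)>1-\alpha_m}V,\qquad\text{where }\alpha_m=\max_{x\in\mathbb{R}^d}D(x;P,\mathcal{U}).$$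
   Context: For a collection $\mathcal{U}$ of Borel subsets of $\mathbb{R}^d$ and a probability measure $P$ on the Borel sets of $\mathbb{R}^d$, the depth function is $D(x;P,\mathcal{U})=\inf\{P(U) : x\in U\in\mathcal{U}\}$ for $x\in\mathbb{R}^d$, and $S_\alpha(P,\mathcal{U})=\{x\in\mathbb{R}^d : D(x;P,\mathcal{U})\ge\alpha\}$. $V^c$ denotes the complement of $V$ in $\mathbb{R}^d$. *)

(* Defs.v *)
From mathcomp Require Import all_boot all_order all_algebra.
From mathcomp Require Import all_classical all_reals all_analysis.
Import Order.TTheory GRing.Theory Num.Theory.
Import numFieldNormedType.Exports.

Set Implicit Arguments.
Unset Strict Implicit.
Unset Printing Implicit Defensive.

Local Open Scope classical_set_scope.
Local Open Scope ring_scope.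

Definition borel_rV (R : realType) (d : nat) :=
  g_sigma_algebraType (@open 'rV[R]_d).

(* The library norm `|x| on 'rV[R]_d is the maximum norm. *)
Definition euclid_norm (R : realType) (d : nat) (x : 'rV[R]_d) : R :=
  Num.sqrt (\sum_(i < d) x ord0 i ^+ 2).

Definition infinity_nbhs (R : realType) (d : nat) : set_system 'rV[R]_d :=
  filter_from [set: R] (fun M => [set x | M < euclid_norm x]).

Global Instance infinity_nbhs_filter (R : realType) (d : nat) :
  Filter (@infinity_nbhs R d).
Proof.
apply: filter_from_filter; first by exists 0.
move=> M N _ _; exists (Num.max M N) => // x /=.
by rewrite gt_max => /andP[].
Qed.

(* Mirror image of the library's lower_semicontinuous. *)
Definition upper_semicontinuous (R : realType) (X : topologicalType)
    (f : X -> \bar R) : Prop :=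
  forall x (a : R), (f x < a%:E)%E ->
    exists2 W, nbhs x W & forall y, W y -> (f y < a%:E)%E.

Definition is_maximum (R : realType) (A : set (\bar R)) (m : \bar R) : Prop :=
  A m /\ ubound A m.

Section depth.
Context (R : realType) (d : nat).
Variables (P : probability (borel_rV R d) R) (UU : set (set 'rV[R]_d)).

(* The infimum is taken in \bar R, where inf set0 = +oo. *)
Definition depth (x : 'rV[R]_d) : \bar R :=
  ereal_inf [set P U | U in [set U | UU U /\ U x]].

Definition depth_region (alpha : R) : set 'rV[R]_d :=
  [set x | (alpha%:E <= depth x)%E].

Definition deepest_points : set 'rV[R]_d :=
  [set x | forall y, (depth y <= depth x)%E].

End depth.

(* Main.v *)
Require Import Defs.
From mathcomp Require Import all_boot all_order all_algebra.
From mathcomp Require Import all_classical all_reals all_analysis.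
Import Order.TTheory GRing.Theory Num.Theory.
Import numFieldNormedType.Exports.

Set Implicit Arguments.
Unset Strict Implicit.
Unset Printing Implicit Defensive.

Local Open Scope classical_set_scope.
Local Open Scope ring_scope.

(** The depth of [x] is an infimum over the members of [UU] that contain [x].
    An open [U] containing [x] contains a whole neighbourhood of [x], so a
    witness that the depth at [x] is below [a] is also a witness at all nearby
    points: this is upper semicontinuity ([depth_upper_semicontinuous]).

    Upper semicontinuity says that superlevel sets are closed.  If moreover the
    depth vanishes at infinity, the superlevel sets of positive level are
    bounded, hence compact ([compact_superlevel]).  The superlevel sets through
    the various values of the depth form a chain of nonempty closed sets, so
    inside a compact one they have a common point, which is a maximizer
    ([superlevel_compact_attains_max]).  Once the maximum [alpha_m] is attained,
    the deepest points are the region of level [alpha_m], which is the smallest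
    nonempty region.  Finally, [x] fails to be deepest exactly when
    [P (~` V) < alpha_m] for some [V] avoiding [x], and this reads
    [1 - alpha_m < P V] ([depth_region_bigcap]). *)

Section semicontinuity.
Context (R : realType) (X : topologicalType) (f : X -> \bar R).
Hypothesis usc_f : upper_semicontinuous f.

Lemma closed_superlevel (c : \bar R) : closed [set x | (c <= f x)%E].
Proof.
rewrite -openC openE => x /= /negP; rewrite -ltNge => fxc.
(* Semicontinuity is tested at real levels: insert one below [c]. *)
have [a fxa ac] : exists2 a : R, (f x < a%:E)%E & (a%:E <= c)%E.
  move: c fxc => [c||] fxc; first by exists c.
  - case: (f x) (fxc) => [r _|//|_].
    + by exists (r + 1)%R; rewrite ?leey// lte_fin ltrDl.
    + by exists 0%R; rewrite ?leey// ltNyr.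
  - by move: fxc; rewrite ltNge leNye.
have [W Wx Wa] := usc_f fxa.
apply: filterS Wx => y /Wa fya /=; apply/negP.
by rewrite -ltNge (lt_le_trans fya).
Qed.

(** The superlevel sets [f y <= f x], for [y] ranging over the space, are
    totally ordered by inclusion, so they generate a proper filter; a cluster
    point of this filter lies in all of them, as they are closed. *)
Lemma superlevel_compact_attains_max (x0 : X) :
  compact [set x | (f x0 <= f x)%E] -> exists p, forall y, (f y <= f p)%E.
Proof.
move=> cpt.
pose F := filter_from [set: X] (fun y => [set x | (f y <= f x)%E]).
have FF : ProperFilter F.
  apply: filter_from_proper; last by move=> y _; exists y => /=.
  apply: filter_from_filter; first by exists x0.
  move=> y z _ _; have [yz|/ltW zy] := leP (f y) (f z).
  - by exists z => // x /= zx; split=> //=; exact: le_trans zx.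
  - by exists y => // x /= yx; split=> //=; exact: le_trans yx.
have [|p [_ Fp]] := cpt F FF; first by exists x0.
exists p => y; move: Fp; rewrite clusterE => /(_ [set x | (f y <= f x)%E]).
by move=> Fp; apply: (closed_superlevel (c := f y)); apply: Fp; exists y.
Qed.

End semicontinuity.

Section euclidean_space.
Context (R : realType) (d : nat).

Lemma norm_le_euclid_norm (x : 'rV[R]_d) : `|x| <= euclid_norm x.
Proof.
rewrite [leLHS]/Num.norm /= mx_normrE; apply/bigmax_leP.
split=> [|[i j] _ /=]; first exact: sqrtr_ge0.
rewrite (ord1 i) -sqrtr_sqr ler_wsqrtr// (bigD1 j)//= lerDl.
by apply: sumr_ge0 => k _; exact: sqr_ge0.
Qed.

(** Vanishing at infinity bounds the Euclidean norm on the superlevel set, hence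
    the maximum norm, and bounded closed sets of row vectors are compact. *)
Lemma compact_superlevel (f : 'rV[R]_d -> \bar R) (c : \bar R) :
    upper_semicontinuous f -> f x @[x --> @infinity_nbhs R d] --> 0%E ->
  (0 < c)%E -> compact [set x | (c <= f x)%E].
Proof.
move=> usc_f f0 c0.
have [M _ fM] := f0 [set y | (y < c)%E] (open_ereal_lt' c0).
apply: bounded_closed_compact; last exact: closed_superlevel.
exists M; split=> [|N MN x /= cfx]; first exact: num_real.
apply: le_trans (norm_le_euclid_norm x) _; rewrite leNgt.
apply/negP => Nx; have /= := fM x (lt_trans MN Nx).
by rewrite ltNge cfx.
Qed.

Lemma closed_borel_measurable (V : set 'rV[R]_d) :
  closed V -> measurable (V : set (borel_rV R d)).
Proof.
move=> clV; rewrite -[V]setCK; apply: measurableC.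
by apply: sub_sigma_algebra; exact: closed_openC.
Qed.

End euclidean_space.

Section depth_theory.
Context (R : realType) (d : nat) (P : probability (borel_rV R d) R).
Variable UU : set (set 'rV[R]_d).

Lemma depth_upper_semicontinuous :
  (forall U, UU U -> open U) -> upper_semicontinuous (depth P UU).
Proof.
move=> opUU x a /ereal_inf_lt[_ [U [UU_U Ux] <-] PUa].
exists U; first by apply: open_nbhs_nbhs; split=> //; exact: opUU.
by move=> y Uy; apply: le_lt_trans PUa; apply: ereal_inf_lbound; exists U.
Qed.

Lemma depth_ge0 x : (0 <= depth P UU x)%E.
Proof. by apply/ereal_infP => _ [U _ <-]. Qed.

(** A point covered by no member of [UU] would have depth [+oo]. *)
Lemma depth_fin_num x U : UU U -> measurable (U : set (borel_rV R d)) -> U x ->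
  depth P UU x \is a fin_num.
Proof.
move=> UU_U mU Ux; rewrite ge0_fin_numE ?depth_ge0//.
apply: (@le_lt_trans _ _ (P U)); first by apply: ereal_inf_lbound; exists U.
by apply: le_lt_trans (probability_le1 P mU) _; exact: ltry.
Qed.

Lemma deepest_points_of_max (p : 'rV[R]_d) (m : R) :
    (forall y, (depth P UU y <= depth P UU p)%E) -> depth P UU p = m%:E ->
  deepest_points P UU = depth_region P UU m.
Proof.
move=> p_max pm; apply/seteqP; split=> x x_max.
  by rewrite /depth_region /= -pm.
by move=> y; apply: le_trans (p_max y) _; rewrite pm.
Qed.

Lemma deepest_points_bigcap_region (p : 'rV[R]_d) (m : R) :
    (forall y, (depth P UU y <= depth P UU p)%E) -> depth P UU p = m%:E ->
  deepest_points P UU =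
    \bigcap_(a in [set a : R | depth_region P UU a !=set0]) depth_region P UU a.
Proof.
move=> p_max pm; apply/seteqP; split=> x x_max.
  by move=> a [y /= ay]; apply: le_trans ay (x_max y).
rewrite (deepest_points_of_max p_max pm); apply: x_max.
by exists p; rewrite /depth_region/= pm.
Qed.

(** Complementation turns the condition [m <= P U] for all [U] containing [x]
    into: every [V] with [1 - m < P V] contains [x]. *)
Lemma depth_region_bigcap (VV : set (set 'rV[R]_d)) (m : R) :
    (forall V, VV V -> closed V) -> UU = [set ~` V | V in VV] ->
  depth_region P UU m =
    \bigcap_(V in [set V | VV V /\ (1 - m%:E < P V)%E]) V.
Proof.
move=> closedVV UUE.
have PC V : VV V -> (P (~` V) < m%:E)%E = (1 - m%:E < P V)%E.
  move=> /closedVV /closed_borel_measurable mV.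
  rewrite probability_setC// -(fineK (fin_num_measure P _ mV)).
  by rewrite -!EFinB !lte_fin ltrBlDr ltrBlDl.
apply/seteqP; split=> x.
  move=> mx V [VV_V]; rewrite -PC// ltNge => /negP PVm.
  apply: contrapT => nVx; apply: PVm; apply: le_trans mx _.
  apply: ereal_inf_lbound; exists (~` V); rewrite // UUE.
  by split=> //; exists V.
move=> xV; apply/ereal_infP => _ [U [UU_U Ux] <-].
move: UU_U Ux; rewrite UUE => -[V VV_V <-] nVx.
by rewrite leNgt PC//; apply/negP => PV; apply/nVx; exact: xV.
Qed.

End depth_theory.

Theorem theorem3p1 (R : realType) (d : nat) (VV UU : set (set 'rV[R]_d))
    (closedVV : forall V, VV V -> closed V)
    (UUE : UU = [set ~` V | V in VV])
    (coverUU : forall x : 'rV[R]_d, exists2 U, UU U & U x)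
    (P : probability (borel_rV R d) R) :
  upper_semicontinuous (depth P UU) /\
  ((exists x, (0 < depth P UU x)%E) ->
   depth P UU x @[x --> @infinity_nbhs R d] --> 0%E ->
   [/\ deepest_points P UU =
         \bigcap_(alpha in [set alpha : R | depth_region P UU alpha !=set0])
           depth_region P UU alpha,
       deepest_points P UU !=set0,
       compact (deepest_points P UU)
     & exists alpha_m : R,
       [/\ is_maximum (range (depth P UU)) alpha_m%:E,
           deepest_points P UU = depth_region P UU alpha_m
         & deepest_points P UU =
             \bigcap_(V in [set V | VV V /\ (1 - alpha_m%:E < P V)%E]) V]]).
Proof.
have opUU : forall U, UU U -> open U.
  by move=> U; rewrite UUE => -[V /closedVV clV <-]; exact: closed_openC.
have usc := @depth_upper_semicontinuous _ _ P _ opUU.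
split=> // -[x0 x0_gt0] lim0.
have cpt := compact_superlevel usc lim0.
have [p p_max] := superlevel_compact_attains_max usc (cpt _ x0_gt0).
have [U UU_U Up] := coverUU p.
have mU : measurable (U : set (borel_rV R d)).
  by apply: sub_sigma_algebra; exact: opUU.
have pm := esym (fineK (depth_fin_num P UU_U mU Up)).
set m := fine _ in pm.
have DE := deepest_points_of_max p_max pm.
split.
- exact: deepest_points_bigcap_region p_max pm.
- by exists p.
- by rewrite DE; apply: cpt; rewrite -pm; exact: lt_le_trans x0_gt0 (p_max x0).
- exists m; split => //; last by rewrite DE; exact: depth_region_bigcap.
  by split; [exists p | move=> _ [y _ <-]; rewrite -pm].
Qed.
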